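(* Let an admissible solution of the problem described in the context be given, with storage flow $y$. Identify $\mathbb B$ with $\{1,\dots,|\mathbb B|\}$, and let $a_{\overline 0,1},\dots,a_{\overline 0,|\mathbb B|}$ be the distinct elements of $\{a\in\mathcal A_{\overline 0}: y_a=1\}$. For $b\in\{1,\dots,|\mathbb B|\}$ consider the sequence of arcs $T^b=(a^b_i)_{i\in\widehat{\mathbb J}}$ defined recursively by $a^b_{\overline 0}=a_{\overline 0,b}$ and, for all $i\in\underline{\mathbb J}\cup\overline{\mathbb J}$, $a^b_i=\theta_i(a^b_{i^-})$, where the mappings $\theta_i$ are defined in the context. Then: (B1) for all $b\in\{1,\dots,|\mathbb B|\}$, $T^b$ is a transport planning; (B2) for two distinct values $b,b'\in\mathbb B$, the paths $T^b$ and $T^{b'}$ do not have any arc in common; (B3) for each active arc $a\in\mathcal A$, that is, each $a\in\mathcal A$ with $y_a=1$, there exists a unique $b\in\mathbb B$ such that $a\in T^b$.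
   Context: **Time indices and data.** $J\ge 1$ is an integer and $\mathbb J=\{1,\dots,J\}$ is the set of days. $\underline{\mathbb J}=\{\underline j: j\in\mathbb J\}$ and $\overline{\mathbb J}=\{\overline j: j\in\mathbb J\}$ are two disjoint copies of $\mathbb J$ (first and second part of each day), and $\widehat{\mathbb J}=\underline{\mathbb J}\cup\overline{\mathbb J}\cup\{\overline 0\}$ is totally ordered by $\overline 0\prec\underline 1\prec\overline 1\prec\dots\prec\underline J\prec\overline J$. $i^+$ and $i^-$ denote successor and predecessor, so $\underline j^+=\overline j$, $\underline j^-=\overline{j-1}$, $\overline j^-=\underline j$. $\mathbb H=\{0,\dots,23\}$; $[n]=\{1,\dots,n\}$; $\mathbf 1_A$ is the indicator function of $A$. $\mathbb S$ (sources), $\mathbb D=\{d_1,\dots,d_{|\mathbb D|}\}$ (destinations), $\mathbb B$ (storages) are finite sets, $\mathbb S\cap\mathbb D=\emptyset$. Further data: $\kappa:\mathbb S\to\mathbb N$; the storage capacity $X^{\max}$; $\overline r_s\ge 0$ for $s\in\mathbb S$; $h_0\in\mathbb H$; $g:\mathbb S\times\mathbb D\to\mathbb R_+$; hourly demands $q_{d,j,h}\ge 0$ with cumulative demands $C_{d,j,h}=\sum_{h'=0}^{h}q_{d,j,h'}$, where $C_{d,j,23}\le X^{\max}$. **Time-expanded graph.** Nodes are elements of $(\mathbb S\cup\mathbb D)\times\widehat{\mathbb J}$. The arc set is $\mathcal A=\underline{\mathcal A}\cup\overline{\mathcal A}\cup\widetilde{\mathcal A}$ with $\underline{\mathcal A}=\big((\mathbb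 S\times\mathbb D)\cup\{(d,d):d\in\mathbb D\}\big)\times\underline{\mathbb J}$, $\overline{\mathcal A}=\big((\mathbb D\times\mathbb S)\cup\{(d,d):d\in\mathbb D\}\big)\times(\overline{\mathbb J}\cup\{\overline 0\})$, $\widetilde{\mathcal A}=\{(s{:}k): s\in\mathbb S,k\in[\kappa(s)]\}\times\widehat{\mathbb J}$. An arc $(v,v',i)$ has tail $(v,i)$ and head $(v',i^+)$; the arc $(s{:}k,i)$ is the $k$-th parallel arc with tail $(s,i)$ and head $(s,i^+)$. The time index of an arc is that of its tail, and $\mathcal A_i$ is the set of arcs with time index $i\in\widehat{\mathbb J}$. (Heads of arcs in $\mathcal A_{\overline J}$ are never used.) **Variables.** Hydrogen flow $f_a\in[0,X^{\max}]$ and storage flow $y_a\in\{0,1\}$ for $a\in\mathcal A$ (values on $\mathcal A_{\overline 0}$ are given data, with $\sum_{a\in\mathcal A_{\overline 0}}y_a=|\mathbb B|$); $z_{d,i}\in[0,X^{\max}]$ for $d\in\mathbb D$, $i\in\underline{\mathbb J}\cup\overline{\mathbb J}$; swap hours $\eta_{d,j}\in\mathbb H$; refills $r_{s,\underline j}\in[0,\overline r_s]$; and, for each $(s,\underline j)$, a bijection $\sigma_{s,\underline j}$ as in (C18). **Admissible solution**: a tuple $(y,f,r,z,\eta,\sigma)$ satisfying, for all $s\in\mathbb S$, $d\in\mathbb D$, $j\in\mathbb J$ (unless otherwise specified): (C1) for all $a\in\mathcal A$: $f_a>0\Rightarrow y_a=1$. (C2) $y_{d,d,i}=1$ for all $i\in\widehat{\mathbb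 J}$. (C3) $f_{d,d,\underline j}=f_{d,d,\underline j^-}-z_{d,\underline j}$. (C4) $D_{d,\underline j}=\sum_{h\in\mathbb H}\mathbf 1_{\{h\}}(\eta_{d,j})\,C_{d,j,h}$. (C5) $z_{d,\underline j}=\min(f_{d,d,\underline j^-},D_{d,\underline j})$. (C6) $\sum_{s\in\mathbb S}y_{s,d,\underline j}\le 1$. (C7) $\sum_{s\in\mathbb S}y_{s,d,\underline j}=\sum_{s\in\mathbb S}y_{d,s,\overline j}$. (C8) $f_{d,d,\underline j}=\mathbf 1_{\{0\}}\big(\sum_{s}y_{s,d,\underline j}\big)f_{d,d,\underline j}+\sum_{s}f_{d,s,\overline j}$. (C9) $f_{d,d,\overline j}=\sum_{s}f_{s,d,\underline j}+\mathbf 1_{\{0\}}\big(\sum_{s}y_{s,d,\underline j}\big)f_{d,d,\underline j}-z_{d,\overline j}$. (C10) $y_{s,d,\underline j}=1\Rightarrow \eta_{d,j}=h_0+g(s,d)$. (C11) $\sum_{s}y_{s,d,\underline j}=0\Rightarrow \eta_{d,j}=12$. (C12) $D_{d,\overline j}=C_{d,j,23}-D_{d,\underline j}$. (C13) $z_{d,\overline j}=\min(f_{d,d,\underline j},D_{d,\overline j})$. (C14) $\sum_{d\in\mathbb D}y_{d,s,\underline j^-}+\sum_{k\in[\kappa(s)]}y_{s:k,\underline j^-}\le\kappa(s)$. (C15) $\sum_{d}y_{d,s,\underline j^-}+\sum_{k}y_{s:k,\underline j^-}=\sum_{d}y_{s,d,\underline j}+\sum_{k}y_{s:k,\underline j}$.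 (C16) $\sum_{d}f_{d,s,\underline j^-}+\sum_{k}f_{s:k,\underline j^-}+r_{s,\underline j}=\sum_{d}f_{s,d,\underline j}+\sum_{k}f_{s:k,\underline j}$. (C17) $r_{s,\underline j}\le\overline r_s$. (C18) Let $N_s=[|\mathbb D|+\kappa(s)]$. For $l\in N_s$ put $f^{\mathrm{in}}_{s,\underline j,l}=f_{d_l,s,\underline j^-}$ if $l\le|\mathbb D|$ and $f_{s:(l-|\mathbb D|),\underline j^-}$ otherwise; $f^{\mathrm{out}}_{s,\underline j,l}=f_{s,d_l,\underline j}$ if $l\le|\mathbb D|$ and $f_{s:(l-|\mathbb D|),\underline j}$ otherwise; define $y^{\mathrm{in}}_{s,\underline j,l}$, $y^{\mathrm{out}}_{s,\underline j,l}$ in the same way with $y$ in place of $f$. Let $I_{s,\underline j}=\{l\in N_s:y^{\mathrm{in}}_{s,\underline j,l}=1\}$ and $O_{s,\underline j}=\{l\in N_s:y^{\mathrm{out}}_{s,\underline j,l}=1\}$ (of equal cardinality by (C15)). Then $\sigma_{s,\underline j}:I_{s,\underline j}\to O_{s,\underline j}$ is a bijection with $f^{\mathrm{in}}_{s,\underline j,l}\le f^{\mathrm{out}}_{s,\underline j,\sigma_{s,\underline j}(l)}$ for all $l\in I_{s,\underline j}$. (C19) if $\kappa(s)\ge2$, for all $k\in[\kappa(s)-1]$: $y_{s:(k+1),\underline j}=1\Rightarrow y_{s:k,\underline j}=1$. (C20) for all $k\in[\kappa(s)]$: $f_{s:k,\underline j}=f_{s:k,\overline j}$ and $y_{s:k,\underline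 j}=y_{s:k,\overline j}$. **Extended bijections.** For each $s,\underline j$, $\overline\sigma_{s,\underline j}:N_s\to N_s$ is a bijection extending $\sigma_{s,\underline j}$ (obtained by choosing any bijection $N_s\setminus I_{s,\underline j}\to N_s\setminus O_{s,\underline j}$); it satisfies $y^{\mathrm{in}}_{s,\underline j,l}=y^{\mathrm{out}}_{s,\underline j,\overline\sigma_{s,\underline j}(l)}$ for all $l\in N_s$. **Mappings $\theta_{\underline j}:\mathcal A_{\underline j^-}\to\mathcal A_{\underline j}$**, $\underline j\in\underline{\mathbb J}$: $(s{:}k,\underline j^-)\mapsto(s,d_{l'},\underline j)$ if $l'\le|\mathbb D|$, and $\mapsto(s{:}(l'-|\mathbb D|),\underline j)$ otherwise, with $l'=\overline\sigma_{s,\underline j}(k+|\mathbb D|)$; $(d_l,s,\underline j^-)\mapsto(s,d_{l'},\underline j)$ if $l'\le|\mathbb D|$, and $\mapsto(s{:}(l'-|\mathbb D|),\underline j)$ otherwise, with $l'=\overline\sigma_{s,\underline j}(l)$; $(d,d,\underline j^-)\mapsto(d,d,\underline j)$. **Mappings $\theta_{\overline j}:\mathcal A_{\overline j^-}\to\mathcal A_{\overline j}$**, $\overline j\in\overline{\mathbb J}$: $(s{:}k,\overline j^-)\mapsto(s{:}k,\overline j)$; $(s,d,\overline j^-)\mapsto(d,d,\overline j)$ if $y_{s,d,\overline j^-}=1$, and $\mapsto(d,\widehat\sigma_{d,\overline j}(s),\overline j)$ otherwise; $(d,d,\overline j^-)\mapsto(d,s,\overline j)$ if there exists $s\in\mathbb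 S$ with $y_{d,s,\overline j}=1$ (such $s$ is unique by (C6),(C7)), and $\mapsto(d,d,\overline j)$ otherwise; where $\widehat\sigma_{d,\overline j}$ is any fixed bijection from $\{s\in\mathbb S:y_{s,d,\overline j^-}=0\}$ to $\{s\in\mathbb S:y_{d,s,\overline j}=0\}$ (which have equal cardinality by (C7)). **Transport planning.** A sequence of arcs $T=(a_i)_{i\in\widehat{\mathbb J}}$ such that the head of $a_i$ equals the tail of $a_{i^+}$ for all $i\in\widehat{\mathbb J}$ with $i\preceq\underline J$, and such that, for all $i\in\widehat{\mathbb J}$, the time index of $a_i$ is $i$ and $y_{a_i}=1$. *)

(* Defs.v *)
From HB Require Import structures.
From mathcomp Require Import all_boot all_order all_algebra all_fingroup zify.
Set Implicit Arguments.
Unset Strict Implicit.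
Unset Printing Implicit Defensive.
Import Order.TTheory GRing.Theory Num.Theory.
Local Open Scope ring_scope.

(* Days are numbered from 0: [j : 'I_J] is the day written j+1 on paper.
   [Lo j] is the first part of that day.  [Up m], with [m : 'I_J.+1], is the
   second part of the day written m on paper, so that [Up ord0] is the extra
   initial index preceding day 1. *)
Inductive time (J : nat) : Type :=
| Lo of 'I_J
| Up of 'I_J.+1.
Arguments Lo {J} _.
Arguments Up {J} _.

Section TimeFinite.
Context {J : nat}.

Definition time_code (i : time J) : 'I_J + 'I_J.+1 :=
  match i with Lo j => inl j | Up m => inr m end.
Definition time_decode (c : 'I_J + 'I_J.+1) : time J :=
  match c with inl j => Lo j | inr m => Up m end.
Lemma time_codeK : cancel time_code time_decode. Proof. by case. Qed.

End TimeFinite.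

HB.instance Definition _ (J : nat) := Finite.copy (time J) (can_type (@time_codeK J)).

Definition up0 {J : nat} : time J := Up ord0.

Definition prv {J : nat} (j : 'I_J) : 'I_J.+1 := widen_ord (leqnSn J) j.
Definition cur {J : nat} (j : 'I_J) : 'I_J.+1 := lift ord0 j.

(* Position in the total order Up 0 < Lo 0 < Up 1 < Lo 1 < ... < Up J. *)
Definition trank {J : nat} (i : time J) : nat :=
  match i with Lo j => j.*2.+1 | Up m => m.*2 end.

(* Successor; [None] exactly for the last index [Up ord_max]. *)
Definition tsucc {J : nat} (i : time J) : option (time J) :=
  match i with
  | Lo j => Some (Up (cur j))
  | Up m => omap Lo (insub (val m))
  end.

Lemma tsuccP (J : nat) (i i' : time J) :
  tsucc i = Some i' <-> trank i' = (trank i).+1.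
Proof.
split.
  case: i => [j [<-]|m] /=; first by rewrite /= /bump; lia.
  by case: insubP => //= j _ jE [<-]; rewrite /= jE.
case: i => [j|m]; case: i' => [j'|m'] /= E; try lia.
  by congr (Some (Up _)); apply: val_inj; rewrite /= /bump; lia.
have mE : m = j' :> nat by lia.
by rewrite mE valK.
Qed.

Definition hour := 'I_24.

Record instance (R : realFieldType) : Type := Instance {
  J : nat;
  Src : finType;
  Dst : finType;
  Sto : finType;
  (* the fixed numbering d_1, ..., d_|Dst| of the destinations, 0-based *)
  dest : 'I_#|Dst| -> Dst;
  dest_index : Dst -> 'I_#|Dst|;
  kappa : Src -> nat;
  Xmax : R;
  rmax : Src -> R;
  h0 : hour;
  g : Src -> Dst -> R;
  q : Dst -> 'I_J -> hour -> R;
  J_gt0 : (0 < J)%N;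
  destK : cancel dest dest_index;
  dest_indexK : cancel dest_index dest;
  rmax_ge0 : forall s, 0 <= rmax s;
  g_ge0 : forall s d, 0 <= g s d;
  q_ge0 : forall d j h, 0 <= q d j h;
  total_demand_le : forall d j, \sum_(h : hour) q d j h <= Xmax
}.

Section Model.
Context {R : realFieldType} (P : instance R).

Local Notation day := ('I_(J P)).
Local Notation S := (Src P).
Local Notation D := (Dst P).

Definition cumdemand (d : D) (j : day) (h : hour) : R :=
  \sum_(h' : hour | (h' <= h)%N) q d j h'.

(* Sources and destinations are disjoint as node sets. *)
Definition node : Type := (S + D)%type.

(* Arcs (s,d,i) exist only for i a first part of a day, arcs (d,s,i) only for
   i a second part (or the initial index). [Par s k i] is the (k+1)-th parallel
   arc from (s,i). *)
Inductive tarc : Type :=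
| SD of S & D & day
| DS of D & S & 'I_(J P).+1
| DD of D & time (J P)
| Par (s : S) of 'I_(kappa s) & time (J P).

Definition atime (a : tarc) : time (J P) :=
  match a with
  | SD _ _ j => Lo j
  | DS _ _ m => Up m
  | DD _ i => i
  | Par _ _ i => i
  end.

Definition asource (a : tarc) : node :=
  match a with
  | SD s _ _ => inl s
  | DS d _ _ => inr d
  | DD d _ => inr d
  | Par s _ _ => inl s
  end.

Definition atarget (a : tarc) : node :=
  match a with
  | SD _ d _ => inr d
  | DS _ s _ => inl s
  | DD d _ => inr d
  | Par s _ _ => inl s
  end.

Definition arc_tail (a : tarc) : node * time (J P) := (asource a, atime a).

(* Arcs at the last time index have no head in the node set. *)
Definition arc_head (a : tarc) : option (node * time (J P)) :=
  omap (pair (atarget a)) (tsucc (atime a)).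

Definition arc_code (a : tarc) :
    (S * D * day) + (D * S * 'I_(J P).+1) + (D * time (J P))
    + ({s : S & 'I_(kappa s)} * time (J P)) :=
  match a with
  | SD s d j => inl (inl (inl (s, d, j)))
  | DS d s m => inl (inl (inr (d, s, m)))
  | DD d i => inl (inr (d, i))
  | Par s k i => inr (existT _ s k, i)
  end.

Definition arc_decode
    (c : (S * D * day) + (D * S * 'I_(J P).+1) + (D * time (J P))
         + ({s : S & 'I_(kappa s)} * time (J P))) : tarc :=
  match c with
  | inl (inl (inl (s, d, j))) => SD s d j
  | inl (inl (inr (d, s, m))) => DS d s m
  | inl (inr (d, i)) => DD d i
  | inr (existT s k, i) => Par k i
  end.

Lemma arc_codeK : cancel arc_code arc_decode. Proof. by case. Qed.

End Model.

HB.instance Definition _ (R : realFieldType) (P : instance R) :=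
  Finite.copy (tarc P) (can_type (@arc_codeK R P)).

Arguments SD {R P} _ _ _.
Arguments DS {R P} _ _ _.
Arguments DD {R P} _ _.
Arguments Par {R P} s _ _.

Section Solutions.
Context {R : realFieldType} (P : instance R).

Local Notation day := ('I_(J P)).
Local Notation S := (Src P).
Local Notation D := (Dst P).

Definition arcs_at (i : time (J P)) : {set tarc P} := [set a | atime a == i].

(* The index set N_s, 0-based: [lshift _ l] stands for the destination number
   l and [rshift _ k] for the parallel arc number k. *)
Definition slot (s : S) : Type := 'I_(#|D| + kappa s).

Definition in_arc (s : S) (j : day) (l : slot s) : tarc P :=
  match split l with
  | inl l' => DS (dest l') s (prv j)
  | inr k => Par s k (Up (prv j))
  end.

Definition out_arc (s : S) (j : day) (l : slot s) : tarc P :=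
  match split l with
  | inl l' => SD s (dest l') j
  | inr k => Par s k (Lo j)
  end.

(* [sol_z_lo], [sol_z_up] are z at the first and second part of the day. Only
   the values of [sol_sigma s j] on [active_in] (defined below) matter. *)
Record solution : Type := Solution {
  sol_y : tarc P -> bool;
  sol_f : tarc P -> R;
  sol_r : S -> day -> R;
  sol_z_lo : D -> day -> R;
  sol_z_up : D -> day -> R;
  sol_eta : D -> day -> hour;
  sol_sigma : forall s : S, day -> slot s -> slot s
}.

Variable sol : solution.
Local Notation y := (sol_y sol).
Local Notation f := (sol_f sol).
Local Notation r := (sol_r sol).
Local Notation z_lo := (sol_z_lo sol).
Local Notation z_up := (sol_z_up sol).
Local Notation eta := (sol_eta sol).
Local Notation sigma := (sol_sigma sol).

Definition active_in (s : S) (j : day) : {set slot s} :=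
  [set l | y (in_arc j l)].
Definition active_out (s : S) (j : day) : {set slot s} :=
  [set l | y (out_arc j l)].

Definition demand_lo (d : D) (j : day) : R :=
  \sum_(h : hour) (eta d j == h)%:R * cumdemand d j h.
Definition demand_up (d : D) (j : day) : R :=
  cumdemand d j ord_max - demand_lo d j.

Definition visits (d : D) (j : day) : nat := (\sum_(s : S) y (SD s d j))%N.
Definition departures (d : D) (j : day) : nat :=
  (\sum_(s : S) y (DS d s (cur j)))%N.

Record admissible : Prop := Admissible {
  f_range : forall a, 0 <= f a <= Xmax P;
  z_lo_range : forall d j, 0 <= z_lo d j <= Xmax P;
  z_up_range : forall d j, 0 <= z_up d j <= Xmax P;
  r_ge0 : forall s j, 0 <= r s j;
  init_storages : (\sum_(a in arcs_at up0) y a)%N = #|Sto P|;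

  flow_active : forall a, 0 < f a -> y a;
  dest_active : forall d i, y (DD d i);
  stock_lo : forall d j,
    f (DD d (Lo j)) = f (DD d (Up (prv j))) - z_lo d j;
  served_lo : forall d j,
    z_lo d j = Num.min (f (DD d (Up (prv j)))) (demand_lo d j);
  visits_le1 : forall d j, (visits d j <= 1)%N;
  visits_departures : forall d j, visits d j = departures d j;
  swap_out : forall d j,
    f (DD d (Lo j)) = (visits d j == 0)%N%:R * f (DD d (Lo j))
                      + \sum_(s : S) f (DS d s (cur j));
  swap_in : forall d j,
    f (DD d (Up (cur j))) = \sum_(s : S) f (SD s d j)
                            + (visits d j == 0)%N%:R * f (DD d (Lo j))
                            - z_up d j;
  swap_hour : forall s d j,
    y (SD s d j) -> (eta d j)%:R = (h0 P)%:R + g s d;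
  noswap_hour : forall d j, visits d j = 0%N -> eta d j = 12%N :> nat;
  served_up : forall d j,
    z_up d j = Num.min (f (DD d (Lo j))) (demand_up d j);
  source_capacity : forall (s : S) j,
    (\sum_(d : D) y (DS d s (prv j))
     + \sum_(k < kappa s) y (Par s k (Up (prv j))) <= kappa s)%N;
  source_balance : forall (s : S) j,
    (\sum_(d : D) y (DS d s (prv j))
     + \sum_(k < kappa s) y (Par s k (Up (prv j)))
     = \sum_(d : D) y (SD s d j) + \sum_(k < kappa s) y (Par s k (Lo j)))%N;
  source_flow : forall (s : S) j,
    \sum_(d : D) f (DS d s (prv j))
    + \sum_(k < kappa s) f (Par s k (Up (prv j))) + r s j
    = \sum_(d : D) f (SD s d j) + \sum_(k < kappa s) f (Par s k (Lo j));
  r_le : forall s j, r s j <= rmax s;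
  sigma_inj : forall s j, {in active_in s j &, injective (sigma j)};
  sigma_onto : forall s j, sigma j @: active_in s j = active_out s j;
  sigma_refill : forall s j (l : slot s), l \in active_in s j ->
    f (in_arc j l) <= f (out_arc j (sigma j l));
  par_order : forall (s : S) j (k k' : 'I_(kappa s)), k' = k.+1 :> nat ->
    y (Par s k' (Lo j)) -> y (Par s k (Lo j));
  par_stay_f : forall (s : S) j (k : 'I_(kappa s)),
    f (Par s k (Lo j)) = f (Par s k (Up (cur j)));
  par_stay_y : forall (s : S) j (k : 'I_(kappa s)),
    y (Par s k (Lo j)) = y (Par s k (Up (cur j)))
}.

Definition extends_sigma (sbar : forall s : S, day -> {perm slot s}) : Prop :=
  forall s j (l : slot s), l \in active_in s j -> sbar s j l = sigma j l.

(* [shat d j] is a bijection between the sources s with (s,d) inactive in the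
   first part of day j and those with (d,s) inactive in the second part; its
   values elsewhere are irrelevant. *)
Definition matches_inactive (shat : D -> day -> S -> S) : Prop :=
  forall d j,
    {in [set s | ~~ y (SD s d j)] &, injective (shat d j)} /\
    shat d j @: [set s | ~~ y (SD s d j)] = [set s | ~~ y (DS d s (cur j))].

(* The mapping of the first part of day j, meant for arcs at time
   [Up (prv j)]; the last branch does not occur there. *)
Definition theta_lo (sbar : forall s : S, day -> {perm slot s}) (j : day)
    (a : tarc P) : tarc P :=
  match a with
  | Par s k _ => out_arc j (sbar s j (rshift #|D| k))
  | DS d s _ => out_arc j (sbar s j (lshift (kappa s) (dest_index d)))
  | DD d _ => DD d (Lo j)
  | SD _ _ _ => a
  end.

(* The mapping of the second part of day j, meant for arcs at time [Lo j];
   the last branch does not occur there. *)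
Definition theta_up (shat : D -> day -> S -> S) (j : day) (a : tarc P) : tarc P :=
  match a with
  | Par s k _ => Par s k (Up (cur j))
  | SD s d _ => if y (SD s d j) then DD d (Up (cur j))
                else DS d (shat d j s) (cur j)
  | DD d _ => if [pick s | y (DS d s (cur j))] is Some s
              then DS d s (cur j) else DD d (Up (cur j))
  | DS _ _ _ => a
  end.

Definition enumerates_initial (a0 : Sto P -> tarc P) : Prop :=
  injective a0 /\ a0 @: [set: Sto P] = [set a in arcs_at up0 | y a].

(* [T b] is the sequence of arcs defined recursively from [a0 b]. *)
Definition follows_theta (sbar : forall s : S, day -> {perm slot s})
    (shat : D -> day -> S -> S) (a0 : Sto P -> tarc P)
    (T : Sto P -> time (J P) -> tarc P) : Prop :=
  forall b,
    [/\ T b up0 = a0 b,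
        forall j, T b (Lo j) = theta_lo sbar j (T b (Up (prv j)))
      & forall j, T b (Up (cur j)) = theta_up shat j (T b (Lo j))].

(* The indices i having a successor are those up to the first part of the
   last day. *)
Definition transport_planning (t : time (J P) -> tarc P) : Prop :=
  (forall i i', tsucc i = Some i' -> arc_head (t i) = Some (arc_tail (t i'))) /\
  (forall i, atime (t i) = i /\ y (t i)).

End Solutions.

(* Main.v *)
Require Import Defs.
From mathcomp Require Import all_boot all_order all_algebra all_fingroup.

(** At every time index, the arcs used by the paths [T b] are exactly the active
    arcs with that index, each used by a single [b].  This holds at the initial
    index by the choice of [a0], and it propagates because each mapping theta
    restricts to a bijection from the active arcs of one index onto the active
    arcs of the next, sending an arc to one that starts where it ends
    ([theta_lo_carries], [theta_up_carries]).

    In the first part of a day, the arcs entering and those leaving a source are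
    numbered by the same set of slots and theta applies the permutation [sbar],
    whose restriction to the active slots is the bijection [sigma].  In the
    second part, only a destination needs attention: it is visited by at most
    one storage, and one storage leaves it exactly when one arrives.  If there
    is a visit, the arriving storage becomes the resident one and the former
    resident leaves; otherwise the resident stays.

    All three claims are then read off from this bijection between storages and
    active arcs of a given index ([follows_theta_layer]). *)

Set Implicit Arguments.
Unset Strict Implicit.
Unset Printing Implicit Defensive.

(** * Time indices and counting *)

Lemma time_ind_succ (J : nat) (Q : time J -> Prop) :
  Q up0 ->
  (forall j, Q (Up (prv j)) -> Q (Lo j)) ->
  (forall j, Q (Lo j) -> Q (Up (cur j))) ->
  forall i, Q i.
Proof.
move=> Q0 Qlo Qup.
have QU n (nJ : n < J.+1) : Q (Up (Ordinal nJ)).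
  elim: n nJ => [|n IHn] nJ.
    by rewrite (_ : Ordinal nJ = ord0) //; apply: val_inj.
  rewrite (_ : Ordinal nJ = cur (Ordinal (nJ : n < J))); last exact: val_inj.
  apply: (Qup); apply: (Qlo).
  rewrite (_ : prv _ = Ordinal (ltnW nJ)); first exact: IHn.
  exact: val_inj.
case=> [j|[m mJ]]; last exact: QU.
by apply: Qlo; case: (prv j) => m mJ; apply: QU.
Qed.

Lemma tsucc_cases (J : nat) (i i' : time J) : tsucc i = Some i' ->
  exists j, (i = Up (prv j) /\ i' = Lo j) \/ (i = Lo j /\ i' = Up (cur j)).
Proof.
case: i => [j [<-]|m] /=; first by exists j; right.
case: insubP => //= j _ jm [<-]; exists j; left; split=> //.
by congr (Up _); apply: val_inj; rewrite /= jm.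
Qed.

Lemma sum_bool_gt0 (I : finType) (p : pred I) :
  (0 < \sum_i p i) = [exists i, p i].
Proof.
rewrite lt0n sum_nat_eq0 negb_forall; apply: eq_existsb => i.
by rewrite eqb0 negbK.
Qed.

Lemma sum_bool_le1 (I : finType) (p : pred I) (i i' : I) :
  \sum_i p i <= 1 -> p i -> p i' -> i = i'.
Proof.
move=> le1 pi pi'; apply/eqP; apply: contraTT le1 => ne.
by rewrite (bigD1 i) //= (bigD1 i') 1?eq_sym //= pi pi'.
Qed.

(** * The mappings theta on active arcs *)

Section Steps.
Context {R : realFieldType} (P : instance R) (sol : solution P).
Local Notation y := (sol_y sol).

Definition active_at (i : time (J P)) : {set tarc P} :=
  [set a in arcs_at i | y a].

Lemma active_atP i a : reflect (atime a = i /\ y a) (a \in active_at i).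
Proof. by rewrite !inE; apply: (iffP andP) => -[/eqP]. Qed.

Definition carries (th : tarc P -> tarc P) (i i' : time (J P)) : Prop :=
  [/\ {in active_at i &, injective th},
      th @: active_at i = active_at i'
    & {in active_at i, forall a, asource (th a) = atarget a}].

Lemma asource_out_arc (s : Src P) j (l : slot s) :
  asource (out_arc j l) = inl s.
Proof. by rewrite /out_arc; case: split. Qed.

Lemma atime_out_arc (s : Src P) j (l : slot s) : atime (out_arc j l) = Lo j.
Proof. by rewrite /out_arc; case: split. Qed.

Lemma atarget_in_arc (s : Src P) j (l : slot s) : atarget (in_arc j l) = inl s.
Proof. by rewrite /in_arc; case: split. Qed.

Lemma atime_in_arc (s : Src P) j (l : slot s) :
  atime (in_arc j l) = Up (prv j).
Proof. by rewrite /in_arc; case: split. Qed.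

Lemma out_arc_inj (s : Src P) j : injective (@out_arc R P s j).
Proof.
move=> l l'; rewrite -[l]splitK -[l']splitK /out_arc !unsplitK.
case: (split l) => u; case: (split l') => v // [].
  by move=> /(can_inj (@destK R P)) ->.
(* The parallel arcs of the sources form a dependent family, whence the
   equality of dependent pairs here. *)
by move=> /eqP; rewrite eq_Tagged => /eqP /= ->.
Qed.

Lemma theta_lo_in_arc (sbar : forall s : Src P, 'I_(J P) -> {perm slot s})
    (s : Src P) j (l : slot s) :
  theta_lo sbar j (in_arc j l) = out_arc j (sbar s j l).
Proof.
rewrite -[in LHS](splitK l) /in_arc unsplitK -[in RHS](splitK l).
by case: (split l) => u //=; rewrite destK.
Qed.

Lemma in_arc_cases (a : tarc P) j : atime a = Up (prv j) ->
  (exists d, a = DD d (Up (prv j))) \/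
  (exists (s : Src P) (l : slot s), a = in_arc j l).
Proof.
case: a => [s d i|d s m|d i|s k i] //= => [[->]|->|->]; last 2 first.
- by left; exists d.
- by right; exists s, (rshift #|Dst P| k); rewrite /in_arc (unsplitK (inr k)).
right; exists s, (lshift (kappa s) (dest_index d)).
by rewrite /in_arc (unsplitK (inl _)) dest_indexK.
Qed.

Lemma out_arc_cases (a : tarc P) j : atime a = Lo j ->
  (exists d, a = DD d (Lo j)) \/
  (exists (s : Src P) (l : slot s), a = out_arc j l).
Proof.
case: a => [s d i|d s m|d i|s k i] //= => [[->]|->|->]; last 2 first.
- by left; exists d.
- by right; exists s, (rshift #|Dst P| k); rewrite /out_arc (unsplitK (inr k)).
right; exists s, (lshift (kappa s) (dest_index d)).
by rewrite /out_arc (unsplitK (inl _)) dest_indexK.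
Qed.

Hypothesis adm : admissible sol.

(** The extended permutations conjugate, slot by slot, the arcs entering each
    source to those leaving it, and they respect activity in both directions
    because they extend the bijection [sigma] between active slots. *)
Lemma theta_lo_carries (sbar : forall s : Src P, 'I_(J P) -> {perm slot s}) j :
  extends_sigma sol sbar ->
  carries (theta_lo sbar j) (Up (prv j)) (Lo j).
Proof.
move=> ext; split.
- move=> a b /active_atP[/in_arc_cases aE _] /active_atP[/in_arc_cases bE _].
  case: aE => [[d ->]|[s [l ->]]]; case: bE => [[d' ->]|[s' [l' ->]]];
    rewrite ?theta_lo_in_arc.
  + by move=> [->].
  + by move=> /(congr1 (@asource R P)); rewrite asource_out_arc.
  + by move=> /(congr1 (@asource R P)); rewrite asource_out_arc.
  + move=> E; have [ss'] : inl s = inl s' :> node P.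
      by rewrite -(asource_out_arc j (sbar s j l)) E asource_out_arc.
    by case: s' / ss' l' E => l' /out_arc_inj/perm_inj ->.
- apply/setP => b; apply/imsetP/idP => [[a] | /active_atP[]].
    move=> /active_atP[/in_arc_cases [[d ->] _|[s [l ->]] yl] ->];
      apply/active_atP.
      by rewrite dest_active.
    rewrite theta_lo_in_arc atime_out_arc; split=> //.
    have l_in : l \in active_in sol s j by rewrite inE.
    have := imset_f (sol_sigma sol j) l_in.
    by rewrite sigma_onto // inE -ext.
  move=> /out_arc_cases [[d ->] _|[s [l ->]] yl].
    by exists (DD d (Up (prv j))) => //; apply/active_atP; rewrite dest_active.
  have : l \in active_out sol s j by rewrite inE.
  rewrite -(sigma_onto adm) => /imsetP[l0 l0_in ->].
  exists (in_arc j l0); last by rewrite theta_lo_in_arc ext.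
  by apply/active_atP; rewrite atime_in_arc; rewrite inE in l0_in.
- move=> a /active_atP[/in_arc_cases [[d ->] //|[s [l ->]]] _].
  by rewrite theta_lo_in_arc asource_out_arc atarget_in_arc.
Qed.

Lemma visit_unique s s' d j : y (SD s d j) -> y (SD s' d j) -> s = s'.
Proof. exact: sum_bool_le1 (visits_le1 adm d j). Qed.

Lemma departure_unique s s' d j :
  y (DS d s (cur j)) -> y (DS d s' (cur j)) -> s = s'.
Proof.
apply: (sum_bool_le1 (p := fun s => y (DS d s (cur j)))).
by have := visits_le1 adm d j; rewrite visits_departures.
Qed.

Lemma visited_departed d j :
  [exists s, y (SD s d j)] = [exists s, y (DS d s (cur j))].
Proof.
rewrite -!sum_bool_gt0.
by have := visits_departures adm d j; rewrite /visits => ->.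
Qed.

(** The resident storage of a destination and the arriving one never compete
    for the stay arc of the next index: the resident leaves exactly when some
    storage arrives ([visited_departed]). *)
Lemma theta_up_carries (shat : Dst P -> 'I_(J P) -> Src P -> Src P) j :
  carries (theta_up sol shat j) (Lo j) (Up (cur j)).
Proof.
(* The arriving storage takes over the stay arc only at a visited destination,
   where the resident does not keep it. *)
have noclash s d : y (SD s d j) ->
    theta_up sol shat j (DD d (Lo j)) <> DD d (Up (cur j)).
  move=> ysd /=; case: pickP => // no_dep _.
  have /existsP[s'] : [exists s, y (DS d s (cur j))].
    by rewrite -visited_departed; apply/existsP; exists s.
  by rewrite no_dep.
have DDdest d d' :
    theta_up sol shat j (DD d (Lo j)) = DD d' (Up (cur j)) -> d = d'.
  by rewrite /=; case: pickP => [s _ //|_ [->]].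
split.
- move=> [s d i|d s m|d i|s k i] [s' d' i'|d' s' m'|d' i'|s' k' i'];
    move=> /active_atP[//= tE yE] /active_atP[//= tE' yE'].
  + case: tE tE' yE yE' => -> [->] yE yE'; rewrite yE yE' => -[dd'].
    by rewrite -dd' in yE' *; rewrite (visit_unique yE yE').
  + case: tE yE => -> yE; rewrite tE' yE => /esym E.
    by have dd' := DDdest _ _ E; rewrite dd' in E; case: (noclash _ _ yE).
  + by case: tE yE => -> ->.
  + case: tE' yE' => -> yE'; rewrite tE yE' => E; exfalso.
    by have dd' := DDdest _ _ E; rewrite dd' in E; case: (noclash _ _ yE').
  + by rewrite tE tE'; do 2!case: pickP => [? _|_] //; case=> ->.
  + by case: pickP.
  + by case: tE' yE' => -> ->.
  + by case: pickP.
  + rewrite tE tE' => -[ss']; case: s' / ss' k' yE' => k' _.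
    by move=> /eqP; rewrite eq_Tagged => /eqP /= ->.
- apply/setP => b; apply/imsetP/idP => [[a] | /active_atP[]].
    case: a => [s d i|d s m|d i|s k i] /active_atP[//= tE yE] ->;
      apply/active_atP.
    + by case: tE yE => -> ->; rewrite dest_active.
    + by case: pickP => [s ys|_] //; rewrite dest_active.
    + by rewrite -par_stay_y // -tE.
  case: b => [s d i|d s m|d i|s k i] //= tE yE.
  + case: tE yE => -> yE; exists (DD d (Lo j)).
      by apply/active_atP; rewrite dest_active.
    rewrite /=; case: pickP => [s' ys'|/(_ s)]; last by rewrite yE.
    by rewrite (departure_unique yE ys').
  + case vis: [exists s, y (SD s d j)].
      have /existsP[s ys] := vis.
      by exists (SD s d j); [apply/active_atP | rewrite /= ys tE].
    exists (DD d (Lo j)); first by apply/active_atP; rewrite dest_active.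
    rewrite /=; case: pickP => [s ys|_]; last by rewrite tE.
    by move: vis; rewrite visited_departed => /existsP[]; exists s.
  + exists (Par s k (Lo j)); last by rewrite /= tE.
    by apply/active_atP; rewrite par_stay_y // -tE.
- move=> [s d i|d s m|d i|s k i] /active_atP[//= tE yE].
  + by case: tE yE => -> ->.
  + by case: pickP.
Qed.

(** * The paths *)

Context (sbar : forall s : Src P, 'I_(J P) -> {perm slot s}).
Context (shat : Dst P -> 'I_(J P) -> Src P -> Src P).
Context (a0 : Sto P -> tarc P) (T : Sto P -> time (J P) -> tarc P).
Hypothesis ext : extends_sigma sol sbar.
Hypothesis init : enumerates_initial sol a0.
Hypothesis rec : follows_theta sol sbar shat a0 T.

Lemma follows_theta_step i i' : tsucc i = Some i' ->
  exists2 th, carries th i i' & forall b, T b i' = th (T b i).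
Proof.
move=> /tsucc_cases[j [[-> ->]|[-> ->]]].
  exists (theta_lo sbar j); first exact: theta_lo_carries.
  by move=> b; have [] := rec b.
exists (theta_up sol shat j); first exact: theta_up_carries.
by move=> b; have [] := rec b.
Qed.

Lemma follows_theta_layer i :
  injective (T^~ i) /\ (T^~ i) @: [set: Sto P] = active_at i.
Proof.
have step i1 i2 : tsucc i1 = Some i2 ->
    injective (T^~ i1) /\ (T^~ i1) @: [set: Sto P] = active_at i1 ->
    injective (T^~ i2) /\ (T^~ i2) @: [set: Sto P] = active_at i2.
  move=> /follows_theta_step[th [th_inj th_im _] TE] [T_inj T_im].
  have T_act b : T b i1 \in active_at i1 by rewrite -T_im (imset_f (T^~ i1)).
  split=> [b b'|]; first by rewrite !TE => /th_inj/T_inj; apply.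
  by rewrite -th_im -T_im -imset_comp; apply: eq_imset => b; apply: TE.
elim/time_ind_succ: i => [|j|j].
- have [a0_inj a0_im] := init.
  have TE b : T b up0 = a0 b by have [] := rec b.
  split=> [b b'|]; first by rewrite !TE => /a0_inj.
  by rewrite /active_at -a0_im; apply: eq_imset.
- by apply: step; rewrite /= valK.
- exact: step.
Qed.

Lemma follows_theta_active b i : atime (T b i) = i /\ y (T b i).
Proof.
apply/active_atP; have [_ <-] := follows_theta_layer i.
exact: (imset_f (T^~ i)).
Qed.

Lemma follows_theta_planning b : transport_planning sol (T b).
Proof.
split=> [i i' ii'|i]; last exact: follows_theta_active.
have [th [_ _ glue] TE] := follows_theta_step ii'.
have [ti _] := follows_theta_active b i.
have [ti' _] := follows_theta_active b i'.
rewrite /arc_head /arc_tail ti ti' ii' TE glue //.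
by apply/active_atP; apply: follows_theta_active.
Qed.

(** An arc carries its time index, so two paths can only meet at equal times. *)
Lemma follows_theta_arc_inj b b' i i' : T b i = T b' i' -> b = b'.
Proof.
move=> E; have [ti _] := follows_theta_active b i.
have [ti' _] := follows_theta_active b' i'.
have ii' : i = i' by rewrite -ti E ti'.
by rewrite -ii' in E; have [T_inj _] := follows_theta_layer i; apply: T_inj.
Qed.

End Steps.

Theorem mainTheorem2 (R : realFieldType) (P : instance R) (sol : solution P)
    (sbar : forall s : Src P, 'I_(J P) -> {perm slot s})
    (shat : Dst P -> 'I_(J P) -> Src P -> Src P)
    (a0 : Sto P -> tarc P) (T : Sto P -> time (J P) -> tarc P) :
  admissible sol ->
  extends_sigma sol sbar ->
  matches_inactive sol shat ->
  enumerates_initial sol a0 ->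
  follows_theta sol sbar shat a0 T ->
  [/\ forall b, transport_planning sol (T b),
      forall b b', b <> b' -> forall i i', T b i <> T b' i'
    & forall a : tarc P, sol_y sol a -> exists! b, exists i, T b i = a].
Proof.
move=> adm ext _ init rec; split=> [b|b b' bb' i i' E|a ya].
- exact: follows_theta_planning rec b.
- exact/bb'/(follows_theta_arc_inj adm ext init rec E).
have [_ im] := follows_theta_layer adm ext init rec (atime a).
have : a \in active_at sol (atime a) by apply/active_atP.
rewrite -im => /imsetP[b _ aE]; exists b; split; first by exists (atime a).
move=> b' [i E].
apply: (follows_theta_arc_inj adm ext init rec (i := atime a) (i' := i)).
by rewrite E -aE.
Qed.
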